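(* Let $G$ be a graph with $n$ vertices and let $\lambda\in\mathbb{N}$ with $\lambda\ge\chi(G)$. Then $$\mathrm{tight}(G;\lambda)=\frac{n}{\lambda}-\frac{1}{\lambda^2}\left.\frac{d}{dp}\log\mathrm{FC}_{\lambda}(G;p)\right|_{p=\lambda^{-1}}.$$
   Context: All graphs are finite and simple, with nonempty vertex set. $\mathbb{N}=\{1,2,\dots\}$, $[\lambda]=\{1,\dots,\lambda\}$, $\chi(G)$ is the chromatic number, and $N_G(v)$ is the set of neighbours of $v$. A partial $\lambda$-assignment of $G=(V,E)$ is a function $f:W\to[\lambda]$ with $W\subseteq V$; write $\operatorname{dom} f=W$ ($W=\emptyset$ and $W=V$ are allowed). It is total if $\operatorname{dom} f=V$. A $\lambda$-colouring of $G$ is a total $\lambda$-assignment in which adjacent vertices have different colours. $\mathrm{Col}(G;\lambda)$ is the set of all $\lambda$-colourings of $G$ and $P(G;\lambda)=|\mathrm{Col}(G;\lambda)|$. A vertex $v\notin\operatorname{dom} f$ is immediately $\lambda$-forced by $f$ if $|\{f(w): w\in N_G(v)\cap\operatorname{dom} f\}|=\lambda-1$; in that case $f;v$ denotes the extension of $f$ to $(\operatorname{dom} f)\cup\{v\}$ that gives $v$ the unique colour of $[\lambda]$ not appearing on its neighbours in $\operatorname{dom} f$. We say $f$ ($\lambda$-)forces a $\lambda$-colouring of $G$ if there is a (possibly empty) sequence of such steps $f=f_0$, $f_i=f_{i-1};v_i$ ($1\le i\le k$, $v_i$ immediately $\lambda$-forced by $f_{i-1}$) with $f_k$ a $\lambda$-colouring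 of $G$. For $C\subseteq V$, $\mathrm{fcol}(G,C;\lambda)$ is the number of partial $\lambda$-assignments $f$ with $\operatorname{dom} f=C$ that force a $\lambda$-colouring of $G$. The forced $\lambda$-colouring polynomial is the polynomial in $p$ $$\mathrm{FC}_{\lambda}(G;p)=\sum_{C\subseteq V}\mathrm{fcol}(G,C;\lambda)\,p^{|C|}(1-\lambda p)^{n-|C|},\qquad n=|V|.$$ A vertex $v$ is tight for a partial $\lambda$-colouring $f$ if it is immediately $\lambda$-forced by $f$ (so $v\notin\operatorname{dom} f$). For a $\lambda$-colouring $g$ of the whole of $G$, a vertex $v$ is a ($\lambda$-)tight vertex of $g$ if it is tight for the restriction $g|_{V\setminus\{v\}}$, i.e. every colour of $[\lambda]$ other than $g(v)$ appears among the neighbours of $v$ under $g$. The average number of tight vertices in a $\lambda$-colouring of $G$ is $$\mathrm{tight}(G;\lambda)=\frac{1}{P(G;\lambda)}\sum_{g\in\mathrm{Col}(G;\lambda)}\#\{v\in V: v\text{ is a tight vertex of } g\}.$$ Here $\log$ is the natural logarithm. *)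

(* Defs.v *)
From mathcomp Require Import all_boot all_order all_algebra.
Set Implicit Arguments.
Unset Strict Implicit.
Unset Printing Implicit Defensive.
Import GRing.Theory.

Record sgraph := SGraph {
  vertex :> finType;
  adj : rel vertex;
  adj_sym : symmetric adj;
  adj_irr : irreflexive adj;
  vertex_gt0 : 0 < #|vertex|
}.

(* The palette [k] is 'I_k, so colours are numbered 0, ..., k - 1; the value
   None means "outside the domain". *)
Definition passign (G : sgraph) (k : nat) := {ffun G -> option 'I_k}.

Section Assignments.
Variables (G : sgraph) (k : nat).
Implicit Types (f g : passign G k) (v w : G) (A C : {set G}).

Definition dom f : {set G} := [set v | f v != None].

Definition total f : bool := dom f == setT.

Definition coloring f : bool :=
  total f && [forall v, forall w, adj v w ==> (f v != f w)].

Definition restrict f A : passign G k :=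
  [ffun v => if v \in A then f v else None].

Definition nbr_colors f v : {set 'I_k} :=
  [set c | [exists w, adj v w && (f w == Some c)]].

Definition imm_forced f v : bool :=
  (v \notin dom f) && (#|nbr_colors f v| == k.-1).

(* f;v -- only meaningful when imm_forced f v holds, in which case (for
   k > 0) exactly one colour lies outside nbr_colors f v. *)
Definition extend f v : passign G k :=
  [ffun w => if w == v then [pick c | c \notin nbr_colors f v] else f w].

Definition force_step f g : bool :=
  [exists v, imm_forced f v && (g == extend f v)].

Definition forces f : bool :=
  [exists g, connect force_step f g && coloring g].

Definition fcol C : nat := #|[set f : passign G k | (dom f == C) && forces f]|.

Definition tight_vertex g v : bool := imm_forced (restrict g (~: [set v])) v.

End Assignments.

Definition Col (G : sgraph) (k : nat) : {set passign G k} :=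
  [set f | coloring f].

Definition P (G : sgraph) (k : nat) : nat := #|Col G k|.

Lemma colorable_ex (G : sgraph) : exists k, 0 < P G k.
Proof.
exists #|G|; apply/card_gt0P; exists [ffun v => Some (enum_rank v)].
rewrite inE; apply/andP; split.
  by apply/eqP/setP => v; rewrite !inE ffunE.
apply/forallP => v; apply/forallP => w; apply/implyP => vw; rewrite !ffunE.
apply/eqP => -[] /enum_rank_inj evw.
by move: vw; rewrite evw adj_irr.
Qed.

Definition chi (G : sgraph) : nat := ex_minn (colorable_ex G).

Local Open Scope ring_scope.

Definition FC (R : nzRingType) (G : sgraph) (k : nat) : {poly R} :=
  \sum_(C : {set G})
    (fcol k C)%:R *: ('X^#|C| * (1 - k%:R *: 'X) ^+ (#|G| - #|C|)).

Definition tight (R : fieldType) (G : sgraph) (k : nat) : R :=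
  (P G k)%:R^-1 * \sum_(g in Col G k) #|[set v : G | tight_vertex g v]|%:R.

(* Main.v *)
Require Import Defs.
From HB Require Import structures.
From mathcomp Require Import all_boot all_order all_algebra.
From mathcomp Require Import all_classical all_reals all_analysis.
From mathcomp Require Import finset ring.
Require Import Defs.
Import Order.TTheory GRing.Theory Num.Theory.
Import numFieldNormedType.Exports.
Local Open Scope ring_scope.

(** Write [k] for the number of colours, [x = 1/k] and [N] for the order of [G].
The term of [FC] at a set [C] carries the factor [(1 - k p) ^ (N - #|C|)],
which vanishes at [p = x] to order [N - #|C|].  So only [C = V] contributes to
the value at [x], and only [C = V] and the sets [V \ {v}] contribute to the
derivative.

A total assignment has no vertex left to force, so it forces a colouring
exactly when it is one, and [fcol V = P G k].  On [V \ {v}] only [v] can be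
forced, and only at the first step; hence restriction to [V \ {v}] is a
bijection from the colourings in which [v] is tight to the assignments counted
by [fcol (V \ {v})], with inverse [f |-> f;v] ([fcol_cosingleton]).  Summing
over [v], the total number [S] of pairs (colouring, tight vertex) is the sum of
the [fcol (V \ {v})] ([sum_tight]).  This gives
- [FC(x) = P x^N] ([FC_at_inv]), positive because [k >= chi G], and
- [FC'(x) = P N x^(N-1) - S k x^(N-1)] ([deriv_FC_at_inv]).

The logarithmic derivative at [x] is therefore [N k - k^2 S / P], and
[S / P] is the average number of tight vertices. *)

Lemma colouring_exists_mono (G : sgraph) (m k : nat) :
  (m <= k)%N -> (0 < P G m)%N -> (0 < P G k)%N.
Proof.
move=> lemk /card_gt0P[f]; rewrite inE => /andP[/eqP ft /forallP fc].
apply/card_gt0P; exists [ffun v => omap (widen_ord lemk) (f v)].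
have fv v : f v != None by have := in_setT v; rewrite -ft inE.
rewrite inE; apply/andP; split.
  by apply/eqP/setP => v; rewrite !inE ffunE; case: (f v) (fv v).
apply/forallP => v; apply/forallP => w; apply/implyP => vw; rewrite !ffunE.
move: (fc v) => /forallP/(_ w); rewrite vw /=.
(* Equality of ordinals compares their values, which widen_ord preserves. *)
by case: (f v) (fv v) => // a _; case: (f w) (fv w).
Qed.

Lemma colouring_exists (G : sgraph) (k : nat) :
  (chi G <= k)%N -> (0 < P G k)%N.
Proof.
move=> lek; apply: (colouring_exists_mono G _ _ lek).
by rewrite /chi; case: ex_minnP.
Qed.

(** Forcing steps only fill vertices outside the domain, so no step leaves a
total assignment. *)
Lemma total_connect {G : sgraph} {k : nat} {f g : passign G k} :
  total f -> connect (@force_step G k) f g -> g = f.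
Proof.
move=> /eqP ft /connectP[[|h s] /=]; first by move=> _ ->.
move=> /andP[/existsP[v /andP[]]].
by rewrite /imm_forced ft in_setT.
Qed.

Lemma total_forces {G : sgraph} {k : nat} (f : passign G k) :
  total f -> forces f = coloring f.
Proof.
move=> ft; apply/existsP/idP => [[g /andP[fg gc]]|fc].
  by rewrite -(total_connect ft fg).
by exists f; rewrite connect0.
Qed.

Lemma fcol_setT (G : sgraph) (k : nat) : fcol k [set: G] = P G k.
Proof.
apply: eq_card => f; rewrite !inE -/(total f).
case: (boolP (total f)) => [/total_forces->//|ft].
by rewrite /coloring (negbTE ft).
Qed.

(** For [k = 0] this fails: [k.-1] is then [0], a vertex can be immediately
forced, but there is no colour to give it. *)
Lemma dom_extend {G : sgraph} {k : nat} {f : passign G k} {v : G} :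
    (0 < k)%N -> imm_forced f v -> dom (extend f v) = v |: dom f.
Proof.
move=> k0 /andP[_ /eqP fv]; apply/setP => w; rewrite !inE ffunE.
case: (eqVneq w v) => //= _; case: pickP => // none.
have : nbr_colors f v = [set: 'I_k].
  by apply/setP => c; have := none c; rewrite in_setT => /negbFE ->.
move=> nT; move: fv; rewrite nT cardsT card_ord.
by case: k k0 {f none nT} => // k _ /eqP; rewrite eqn_leq ltnn.
Qed.

(** An immediately forced vertex sees all colours but one, so any colour absent
from its neighbourhood is the one that [extend] picks. *)
Lemma extend_unique {G : sgraph} {k : nat} {f : passign G k} {v : G}
    (c : 'I_k) :
  imm_forced f v -> c \notin nbr_colors f v -> extend f v v = Some c.
Proof.
move=> /andP[_ /eqP fv] cN; rewrite ffunE eqxx.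
have k0 : (0 < k)%N by apply: leq_ltn_trans (ltn_ord c).
have /cards1P[d dE] : #|~: nbr_colors f v| == 1%N.
  by rewrite cardsCs setCK fv card_ord -subn1 subKn.
have inN e : (e \notin nbr_colors f v) = (e == d).
  by rewrite -in_setC dE inE.
case: pickP => [e|/(_ c)]; last by rewrite cN.
by move: cN; rewrite !inN => /eqP-> /eqP->.
Qed.

(** In a colouring, the colour of [v] is absent from its neighbours, so it is
the colour that forcing [v] gives back. *)
Lemma extend_restrict {G : sgraph} {k : nat} (g : passign G k) (v : G) :
  coloring g -> tight_vertex g v -> extend (restrict g (~: [set v])) v = g.
Proof.
move=> /andP[/eqP gt gc] tv; apply/ffunP => w.
case: (eqVneq w v) => [->|wv]; last by rewrite ffunE (negbTE wv) ffunE !inE wv.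
have := in_setT v; rewrite -gt inE.
case gv: (g v) => [c|] // _; apply: extend_unique tv _.
rewrite inE; apply/existsP => -[w' /andP[vw']].
rewrite ffunE !inE; case: (eqVneq w' v) => //= _ /eqP gw'.
move: gc => /forallP/(_ v)/forallP/(_ w').
by rewrite vw' gv gw' eqxx.
Qed.

(** The first step can only force [v], and after it the assignment is total, so
the forcing process has length exactly one. *)
Lemma forces_cosingleton {G : sgraph} {k : nat} (f : passign G k) (v : G) :
    (0 < k)%N -> dom f = ~: [set v] -> forces f ->
  imm_forced f v && coloring (extend f v).
Proof.
move=> k0 fd /existsP[g /andP[/connectP[[|h s] /= + gE]]].
  rewrite gE => _ /andP[/eqP ft _].
  by have := in_setT v; rewrite -ft fd !inE eqxx.
move=> /andP[/existsP[w /andP[fw /eqP hE]]]; rewrite {h}hE in gE * => hs gc.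
have wv : w = v by move: fw => /andP[]; rewrite fd !inE negbK => /eqP.
rewrite {w}wv in fw gE hs.
have ft : total (extend f v).
  by rewrite /total (dom_extend k0 fw) fd setUCr.
rewrite fw /=; have <- // : g = extend f v.
by apply: (total_connect ft); apply/connectP; exists s.
Qed.

Lemma restrict_extend {G : sgraph} {k : nat} (f : passign G k) (v : G) :
  dom f = ~: [set v] -> restrict (extend f v) (~: [set v]) = f.
Proof.
move=> fd; apply/ffunP => w; rewrite !ffunE.
have : (w \in dom f) = (w != v) by rewrite fd !inE.
by rewrite !inE; case: (eqVneq w v) => //= _ /negbFE/eqP->.
Qed.

(** Restriction to the complement of [v] and extension at [v] are mutually
inverse, by [extend_restrict] and [restrict_extend]. *)
Lemma fcol_cosingleton (G : sgraph) (k : nat) (v : G) : (0 < k)%N ->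
  fcol k (~: [set v]) = #|[set g in Col G k | tight_vertex g v]|.
Proof.
move=> k0; rewrite -(card_in_imset (f := fun g => restrict g (~: [set v]))).
  apply: eq_card => f; rewrite !inE; apply/andP/imsetP => [[/eqP fd ff]|].
    have /andP[fv ec] := forces_cosingleton _ _ k0 fd ff.
    exists (extend f v); last by rewrite restrict_extend.
    by rewrite !inE ec /= /tight_vertex restrict_extend.
  move=> [g]; rewrite !inE => /andP[gc tv] ->; split.
    apply/eqP/setP => w; rewrite !inE ffunE !inE.
    case: (eqVneq w v) => //= _; move: gc => /andP[/eqP gt _].
    by have := in_setT w; rewrite -gt inE.
  apply/existsP; exists g; rewrite gc andbT; apply: connect1.
  by apply/existsP; exists v; rewrite extend_restrict // eqxx andbT.
move=> g h; rewrite !inE => /andP[gc gv] /andP[hc hv] E.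
by rewrite -(extend_restrict g v) // E extend_restrict.
Qed.

(** Double counting of the pairs of a colouring and a vertex tight in it. *)
Lemma sum_tight (G : sgraph) (k : nat) : (0 < k)%N ->
  (\sum_(g in Col G k) #|[set v : G | tight_vertex g v]| =
   \sum_(v : G) fcol k (~: [set v]))%N.
Proof.
move=> k0; under eq_bigr do rewrite -sum1dep_card big_mkcond.
rewrite exchange_big; apply: eq_bigr => v _ /=.
rewrite fcol_cosingleton // -sum1_card -big_mkcondr.
by apply: eq_bigl => g; rewrite !inE.
Qed.

(** The point [x^-1] is a zero of order [b] of this product, so its derivative
there vanishes unless [b <= 1]; for [b = 1] the only surviving summand comes
from differentiating the linear factor, of slope [- x]. *)
Lemma deriv_term (F : fieldType) (x : F) (a b : nat) : x != 0 ->
  ('X^a * (1 - x *: 'X) ^+ b)^`().[x^-1] =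
  (b == 0)%:R * (a%:R * x^-1 ^+ a.-1) - (b == 1)%:R * (x * x^-1 ^+ a).
Proof.
move=> x0; rewrite derivM derivXn deriv_exp derivB derivZ derivX derivC.
rewrite !(hornerE, horner_exp, hornerMn) mulfV // subrr.
rewrite -[X in X * _ + _]mulr_natl.
by case: b => [|[|b]]; rewrite ?expr0n /=; ring.
Qed.

Lemma cosize_eq0 (T : finType) (C : {set T}) :
  (#|T| - #|C| == 0)%N = (C == [set: T]).
Proof. by rewrite subn_eq0 -cardsT eqEcard subsetT. Qed.

Lemma FC_at_inv (F : fieldType) (G : sgraph) (k : nat) : k%:R != 0 :> F ->
  (FC F G k).[k%:R^-1] = (P G k)%:R * k%:R^-1 ^+ #|G|.
Proof.
move=> k0; rewrite /FC horner_sum (bigD1 [set: G]) //= big1 => [|C CT].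
  by rewrite fcol_setT cardsT subnn expr0 mulr1 addr0 hornerZ hornerXn.
rewrite hornerZ hornerM hornerXn horner_exp hornerD hornerN hornerZ hornerX.
rewrite hornerC mulfV // subrr expr0n.
by rewrite cosize_eq0 (negbTE CT) mulr0n !mulr0.
Qed.

Lemma sum_cosingleton (F : fieldType) (G : sgraph) (E : {set G} -> F) :
  \sum_(C : {set G} | (#|G| - #|C| == 1)%N) E C = \sum_(v : G) E (~: [set v]).
Proof.
have inj : injective (fun v : G => ~: [set v]).
  by move=> v w /(can_inj (@setCK _)) /set1_inj.
transitivity (\sum_(C in [set ~: [set v] | v in G]) E C); last first.
  by rewrite big_imset // => v w _ _; exact: inj.
apply: eq_bigl => C; rewrite -[C in LHS]setCK -cardsCs.
apply/cards1P/imsetP => [[v Cv]|[v _ ->]]; exists v; rewrite ?setCK //.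
by rewrite -Cv setCK.
Qed.

Lemma deriv_FC_at_inv (F : fieldType) (G : sgraph) (k : nat) : k%:R != 0 :> F ->
  (FC F G k)^`().[k%:R^-1] =
  (P G k)%:R * (#|G|%:R * k%:R^-1 ^+ #|G|.-1)
  - (\sum_(v : G) fcol k (~: [set v]))%:R * (k%:R * k%:R^-1 ^+ #|G|.-1).
Proof.
move=> k0; rewrite /FC raddf_sum horner_sum /=.
under [LHS]eq_bigr => C _ do rewrite derivZ hornerZ deriv_term // mulrBr.
rewrite sumrB; congr (_ - _).
  rewrite (bigD1 [set: G]) //= big1 => [|C CT].
    by rewrite fcol_setT cardsT subnn mul1r addr0.
  by rewrite cosize_eq0 (negbTE CT) mulr0n mul0r mulr0.
rewrite (bigID (fun C : {set G} => (#|G| - #|C| == 1)%N)) /= [X in _ + X]big1.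
  rewrite addr0 sum_cosingleton natr_sum mulr_suml; apply: eq_bigr => v _.
  by rewrite cardsCs setCK cards1 subKn ?subn1 ?mul1r // vertex_gt0.
by move=> C /negbTE ->; rewrite mul0r mulr0.
Qed.

Theorem theorem12 (R : realType) (G : sgraph) (n lambda : nat)
    (hn : #|G| = n) (hlambda0 : (0 < lambda)%N)
    (hlambda : (chi G <= lambda)%N) :
  [/\ 0 < (FC R G lambda).[lambda%:R^-1],
      derivable (fun p : R => ln (FC R G lambda).[p]) lambda%:R^-1 1 &
      tight R G lambda =
        n%:R / lambda%:R
        - (lambda%:R ^+ 2)^-1
          * derive1 (fun p : R => ln (FC R G lambda).[p]) lambda%:R^-1].
Proof.
have k0 : lambda%:R != 0 :> R by rewrite pnatr_eq0 -lt0n.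
have P0 : 0 < (P G lambda)%:R :> R by rewrite ltr0n colouring_exists.
have n0 : (0 < n)%N by rewrite -hn vertex_gt0.
have FC0 : 0 < (FC R G lambda).[lambda%:R^-1].
  by rewrite FC_at_inv // mulr_gt0 // exprn_gt0 // invr_gt0 ltr0n.
have D : is_derive (lambda%:R^-1 : R) 1 (fun p : R => ln (FC R G lambda).[p])
    ((FC R G lambda).[lambda%:R^-1]^-1 * (FC R G lambda)^`().[lambda%:R^-1]).
  exact: (@is_derive1_comp _ (@ln R) (horner (FC R G lambda)) _ _ _
    (is_derive1_ln FC0) _).
split => //; rewrite derive1E derive_val.
rewrite deriv_FC_at_inv // FC_at_inv // -sum_tight // hn /tight -natr_sum.
(* Both the value and the derivative are multiples of [y], the power of
   exponent [n - 1], which cancels in the quotient. *)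
have -> : lambda%:R^-1 ^+ n = lambda%:R^-1 * lambda%:R^-1 ^+ n.-1 :> R.
  by rewrite -exprS prednK.
set S := (\sum_(g in _) _)%:R; set y := _ ^+ n.-1.
have y0 : y != 0 by rewrite expf_neq0 // invr_eq0.
by field; rewrite k0 y0 gt_eqF.
Qed.
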